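(* Let $X$ be an Archimedean pervasive pre-Riesz space and $I\subseteq X$ a directed ideal. Then the following statements are equivalent: (i) $I$ is s-closed; (ii) for every subset $A\subseteq I$: if $\sup A$ exists in $X$, then $\sup A\in I$.
   Context: An ordered vector space is a real vector space $X$ with the partial order given by a cone $X_+$ ($x\le y$ iff $y-x\in X_+$); it is Archimedean if $nx\le y$ for all $n\in\mathbb{N}$ implies $x\le 0$. Put $[a,b]:=\{x\in X: a\le x\le b\}$. A subset $A\subseteq X$ is directed if for all $x,y\in A$ there are $z_1,z_2\in A$ with $z_1\le x,y\le z_2$. A linear subspace $X_0$ of an ordered vector space $Y$ is order dense in $Y$ if $y=\inf\{z\in X_0: y\le z\}$ for every $y\in Y$. $X$ is a pre-Riesz space if there are a vector lattice $Y$ and a bipositive linear map $i:X\to Y$ (i.e. $x\ge0 \Leftrightarrow i(x)\ge 0$) with $i(X)$ order dense in $Y$; then $(Y,i)$ is called a vector lattice cover of $X$. $X$ is pervasive if for some (equivalently, every) vector lattice cover $(Y,i)$ and every $y\in Y_+$, $y\ne0$, there is $x\in X$ with $0<i(x)\le y$. For $M\subseteq X$ let $M^u$ be the set of all upper bounds of $M$ in $X$. A set $M\subseteq X$ is solid if for all $x\in X$, $y\in M$, $\{x,-x\}^u\supseteq\{y,-y\}^u$ implies $x\in M$; an ideal is a solid linear subspace. An ideal $I$ is s-closed (supremum closed) if for every $z\in X_+$ the relation $z=\sup(I\cap[0,z])$ (meaning that the supremum exists in $X$ and equals $z$) implies $z\in I$. *)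

(* Defs.v *)
From HB Require Import structures.
From mathcomp Require Import all_boot all_order all_algebra.
From mathcomp Require Import boolp classical_sets functions set_interval reals.

Set Implicit Arguments.
Unset Strict Implicit.
Unset Printing Implicit Defensive.

Import Order.TTheory GRing.Theory Num.Theory.

Local Open Scope classical_set_scope.
Local Open Scope ring_scope.

(* An ordered vector space: the order is the one given by the cone
   [set x | 0 <= x].  That the cone is pointed (x = 0 as soon as x and - x lie
   in it) and contains 0 is antisymmetry and reflexivity of the order. *)
HB.mixin Record Lmodule_isConeOrdered (R : numDomainType) V
    of GRing.Lmodule R V & Order.isPOrder ring_display V := {
  lev_cone : forall x y : V, (x <= y) = (0 <= y - x);
  coneD : forall x y : V, 0 <= x -> 0 <= y -> 0 <= x + y;
  coneZ : forall (a : R) (x : V), 0 <= a -> 0 <= x -> 0 <= a *: x }.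

#[short(type="orderedLmodType")]
HB.structure Definition OrderedLmodule (R : numDomainType) :=
  { V of GRing.Lmodule R V & Order.isPOrder ring_display V
       & Lmodule_isConeOrdered R V }.

Section OrderedLmoduleTheory.
Variables (R : realType) (X : orderedLmodType R).
Implicit Types (x y z : X) (A M I : set X).

Definition vector_lattice : Prop :=
  forall x y, (exists z, supremums [set x; y] z) /\
              (exists z, infimums [set x; y] z).

Definition archimedean : Prop :=
  forall x y, (forall n : nat, (0 < n)%N -> x *+ n <= y) -> x <= 0.

Definition directed A : Prop :=
  forall x y, A x -> A y ->
    exists z1 z2, [/\ A z1, A z2, z1 <= x /\ z1 <= y & x <= z2 /\ y <= z2].

Definition order_dense A : Prop :=
  forall y, infimums [set z | A z /\ y <= z] y.

Definition solid M : Prop :=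
  forall x y, M y -> ubound [set y; - y] `<=` ubound [set x; - x] -> M x.

Definition ideal I : Prop := submod_closed (mem I) /\ solid I.

(* [supremums A z] says that the supremum of A exists and equals z. *)
Definition s_closed I : Prop :=
  forall z, 0 <= z -> supremums (I `&` `[0, z]) z -> I z.

End OrderedLmoduleTheory.

Arguments vector_lattice {R} X.
Arguments archimedean {R} X.

Section PreRiesz.
Variables (R : realType) (X : orderedLmodType R).

Definition bipositive (Y : orderedLmodType R) (i : X -> Y) : Prop :=
  forall x, 0 <= x <-> 0 <= i x.

Definition vector_lattice_cover (Y : orderedLmodType R)
    (i : {linear X -> Y}) : Prop :=
  [/\ vector_lattice Y, bipositive i & order_dense (range i)].

Definition pre_riesz : Prop :=
  exists (Y : orderedLmodType R) (i : {linear X -> Y}),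
    vector_lattice_cover i.

(* The condition does not depend on the vector lattice cover; it is required
   of some cover. *)
Definition pervasive : Prop :=
  exists (Y : orderedLmodType R) (i : {linear X -> Y}),
    vector_lattice_cover i /\
    forall y : Y, 0 <= y -> y <> 0 -> exists x, 0 < i x /\ i x <= y.

End PreRiesz.

Arguments pre_riesz {R} X.
Arguments pervasive {R} X.

(* Main.v *)
(** In the Archimedean pervasive case every positive y in the vector lattice
    cover is the least upper bound of the elements of X between 0 and y: were u
    an upper bound not above y, some x > 0 in X would lie below y - u /\ y,
    and then every multiple n x would stay below y, hence below u.  Now let
    s = sup A, a in A and z = s - a.  Each b in A - a has its positive part
    b^+ (in the cover) dominated by z and by an element of the directed ideal
    I, so the elements of X between 0 and b^+ lie in I and below z.  An upper
    bound of I on [0, z] is therefore above b^+, hence above b; so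
    z = sup (I on [0, z]) lies in I, and s = z + a does too. *)
Require Import Defs.
From mathcomp Require Import all_boot all_order all_algebra.
From mathcomp Require Import boolp classical_sets reals.

Import Order.TTheory GRing.Theory.

Local Open Scope classical_set_scope.

Section OrderedLmodule.
Local Open Scope ring_scope.
Context {R : realType} {X : orderedLmodType R}.
Implicit Types (x y z : X) (I : set X).

Lemma lev_add2r z x y : (x + z <= y + z) = (x <= y).
Proof. by rewrite lev_cone [RHS]lev_cone opprD addrACA subrr addr0. Qed.

Lemma lev_subr_addr x y z : (x <= y - z) = (x + z <= y).
Proof. by rewrite -(lev_add2r z x) subrK. Qed.

Lemma lev_subl_addr x y z : (x - z <= y) = (x <= y + z).
Proof. by rewrite -(lev_add2r z _ y) subrK. Qed.

Lemma oppv_le0 x : (- x <= 0) = (0 <= x).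
Proof. by rewrite -[- x]add0r lev_subl_addr add0r. Qed.

Lemma solid_between I x y : solid I -> I y -> 0 <= x -> x <= y -> I x.
Proof.
move=> solI Iy x0 xy; apply: (solI x y Iy) => v uv t.
have yv : y <= v by apply: uv; left.
have xv : x <= v := le_trans xy yv.
case=> ->; first by [].
by apply: le_trans (le_trans x0 xv); rewrite oppv_le0.
Qed.

(** Every element bounds the empty set from above, so [z] lies below both [0] and [z + z]. *)
Lemma supremum_set0 z : supremums set0 z -> z = 0.
Proof.
move=> [_ lz]; apply: le_anti; apply/andP; split; first exact: lz.
by rewrite -(lev_add2r z) add0r; apply: lz.
Qed.

End OrderedLmodule.

Section Cover.
Local Open Scope ring_scope.
Context {R : realType} {X Y : orderedLmodType R} (i : {linear X -> Y}).

Lemma bipositive_le (x y : X) : bipositive i -> (i x <= i y) = (x <= y).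
Proof.
move=> bip; rewrite lev_cone [RHS]lev_cone -linearB.
by apply/idP/idP => /bip.
Qed.

Lemma pervasive_sup_below (y : Y) (u : X) :
  archimedean X -> vector_lattice Y -> bipositive i ->
  (forall y : Y, 0 <= y -> y <> 0 -> exists x, 0 < i x /\ i x <= y) ->
  0 <= y ->
  (forall x : X, 0 <= x -> i x <= y -> x <= u) -> y <= i u.
Proof.
move=> arch latY bip perv y0 uub.
have [_ [w [lw gw]]] := latY (i u) y.
have wu : w <= i u by apply: lw; left.
have wy : w <= y by apply: lw; right.
have [yw0|ywN0] := eqVneq (y - w) 0; first by rewrite (subr0_eq yw0).
have yw : 0 <= y - w by rewrite -lev_cone.
have [x [ix_gt0 ix_le]] := perv _ yw (elimN eqP ywN0).
have x0 : 0 <= x by apply/bip/ltW.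
(* By [uub], [i (x *+ n)] is below [i u] as well as [y], hence below [w]; since [i x <= y - w], one
   more [x] still fits under [y]. *)
have below n : 0 <= x *+ n /\ i (x *+ n) <= y.
  elim: n => [|n [xn0 xny]]; first by rewrite mulr0n linear0.
  split; first by rewrite mulrS; apply: coneD.
  rewrite mulrSr linearD; apply: (@le_trans _ _ (w + i x)).
    rewrite lev_add2r; apply: gw => t [->|->] //.
    by rewrite bipositive_le//; apply: uub.
  by rewrite addrC -lev_subr_addr.
have : x <= 0 by apply: (arch x u) => n _; have [] := below n; apply: uub.
by rewrite -(bipositive_le _ _ bip) linear0 (lt_geF ix_gt0).
Qed.

End Cover.

Theorem proposition8 (R : realType) (X : orderedLmodType R) (I : set X) :
  archimedean X -> pre_riesz X -> pervasive X ->
  ideal I -> directed I ->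
  (s_closed I <->
   forall A : set X, A `<=` I -> forall s : X, supremums A s -> I s).
Proof.
move=> arch _ [Y [i [[latY bip _] perv]]] [[subI0 subI] solI] dirI.
have I0 : I 0%R by move: subI0; rewrite in_setE.
have ID x y : I x -> I y -> I (x + y)%R.
  move=> Ix Iy; have := subI 1%R x y.
  by rewrite !in_setE scale1r; apply.
have IB x y : I x -> I y -> I (x - y)%R.
  move=> Ix Iy; have := subI (-1)%R y x.
  by rewrite !in_setE scaleN1r addrC; apply.
split=> [scl A AI s supA|supI z _]; last by apply: supI => x [].
have [A0|/set0P[a Aa]] := eqVneq A set0.
  by rewrite A0 in supA; rewrite (supremum_set0 _ supA).
have [uA lA] := supA.
rewrite -(subrK a s); apply: (ID); last exact: AI.
have z0 : (0 <= s - a)%R by rewrite -lev_cone; apply: uA.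
apply: scl => //; split=> [x [_] /=|u uI]; first by rewrite in_itv /= => /andP[].
(* It suffices that [u + a] bounds [A] from above. *)
rewrite lev_subl_addr; apply: lA => c Ac.
rewrite -lev_subl_addr; set b := (c - a)%R.
have Ib : I b by apply: IB; apply: AI.
have bz : (b <= s - a)%R by rewrite lev_add2r; apply: uA.
have [_ [d [_ Id _ [bd d0]]]] := dirI b 0%R Ib I0.
(* [p] is the positive part of [i b]; it may lie outside the range of [i]. *)
have [[p [up lp]] _] := latY (i b) 0%R.
have bp : (i b <= p)%R by apply: up; left.
have p0 : (0 <= p)%R by apply: up; right.
have p_le v : (b <= v)%R -> (0 <= v)%R -> (p <= i v)%R.
  move=> bv v0; apply: lp => t [->|->]; first by rewrite bipositive_le.
  exact/bip.
rewrite -(bipositive_le i)//; apply: (le_trans bp).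
apply: pervasive_sup_below => // x x0 xp.
(* Taken at [v = d], this puts [x] into [I] by solidity; at [v = s - a], into the interval. *)
have x_le v : (b <= v)%R -> (0 <= v)%R -> (x <= v)%R.
  by move=> bv v0; rewrite -(bipositive_le i)//; apply: le_trans xp (p_le v bv v0).
apply: uI; split; first exact: (solid_between _ _ _ solI Id x0 (x_le d bd d0)).
by rewrite /= in_itv /= x0 x_le.
Qed.
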